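(* Let $\lambda_1\ge\cdots\ge\lambda_k>0$ and, for $\theta>0$, let $$B(\theta)=C_D(\theta)\Big(ku+\gamma_n\sum_{i=1}^k\Big|1-\frac{\theta}{\lambda_i}\Big|\Big),\qquad C_D(\theta)=\begin{cases}\dfrac{\theta}{\lambda_k},&\theta\ge\lambda_1,\\[2mm]\dfrac{\lambda_1}{\lambda_k},&\lambda_k\le\theta<\lambda_1,\\[2mm]\dfrac{\lambda_1}{\theta},&0<\theta<\lambda_k,\end{cases}$$ which is the first-order (in the unit roundoff $u$) upper bound on the relative forward error of applying the spectral limited-memory preconditioner to a vector in the dominant subspace. Then $B$ is minimized over $\theta>0$ by taking $\theta$ to be a weighted median of $\{\lambda_1,\dots,\lambda_k\}$ with weights $w_i=1/\lambda_i$.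
   Context: $u>0$ is the unit roundoff, $n\ge k\ge1$ are integers with $nu<1$, and $\gamma_n=\frac{nu}{1-nu}$. A weighted median of real numbers $x_1,\dots,x_k$ with weights $w_1,\dots,w_k\ge0$, $W=\sum_iw_i$, is a number $m\in[\min_ix_i,\max_ix_i]$ such that $\sum_{i:\,x_i<m}w_i\le W/2$ and $\sum_{i:\,x_i>m}w_i\le W/2$. *)

(* Defs.v *)
From HB Require Import structures.
From mathcomp Require Import all_boot all_order all_algebra.

Set Implicit Arguments.
Unset Strict Implicit.
Unset Printing Implicit Defensive.

Import Order.TTheory GRing.Theory Num.Theory.
Local Open Scope ring_scope.

(* A family indexed by {1, ..., k} with k >= 1 is a function on 'I_p.+1, where
   k = p.+1: index 1 is ord0 and index k is ord_max. *)

Definition gamma (R : realFieldType) (u : R) (n : nat) : R :=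
  n%:R * u / (1 - n%:R * u).

Definition weighted_median (R : realFieldType) (p : nat)
    (x w : 'I_p.+1 -> R) (m : R) : Prop :=
  let W := \sum_i w i in
  [/\ forall i, 0 <= w i,
      \big[Num.min/x ord0]_i x i <= m <= \big[Num.max/x ord0]_i x i,
      \sum_(i | x i < m) w i <= W / 2%:R
    & \sum_(i | m < x i) w i <= W / 2%:R].

Definition CD (R : realFieldType) (p : nat) (lam : 'I_p.+1 -> R) (theta : R) : R :=
  if lam ord0 <= theta then theta / lam ord_max
  else if lam ord_max <= theta then lam ord0 / lam ord_max
  else lam ord0 / theta.

Definition fwd_bound (R : realFieldType) (u : R) (n p : nat)
    (lam : 'I_p.+1 -> R) (theta : R) : R :=
  CD lam theta *
  (p.+1%:R * u + gamma u n * \sum_i `|1 - theta / lam i|).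

Definition minimizer_on_pos (R : realFieldType) (f : R -> R) (m : R) : Prop :=
  0 < m /\ forall theta : R, 0 < theta -> f m <= f theta.

(* Main.v *)
Require Import Defs.
From mathcomp Require Import all_boot all_order all_algebra.
From mathcomp Require Import lra.
Import Order.TTheory GRing.Theory Num.Theory.
Local Open Scope ring_scope.

(** The bound is a product of two nonnegative factors, and a weighted median
    minimizes both of them at once.

    The factor [CD lam] attains its minimum, the condition number
    [lam ord0 / lam ord_max], exactly on the interval
    [[lam ord_max, lam ord0]], which contains every median ([CD_ge],
    [CD_spectrum]).  The other factor is an increasing affine function of
    [\sum_i `|1 - theta / lam i|], which is the weighted sum of distances
    [\sum_i w_i * `|lam i - theta|] with [w_i = 1 / lam i].  Such a sum is
    minimized by weighted medians ([weighted_median_minimizes]): when the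
    point moves away from a median, at least half of the weight recedes at
    full speed, and at most half gets closer.

    A weighted median exists for any nonnegative weights, and can be found
    among the points themselves ([weighted_median_exists]). *)

(** Moving from [m] to the right to [t] lengthens the distance to each point
    at or below [m] by exactly [t - m], and shortens no other distance by more
    than that.  The total change is thus at least [t - m] times the difference
    between these two weights, which the hypothesis makes nonnegative. *)
Lemma weighted_dist_le_right (R : realFieldType) (I : finType)
    (x w : I -> R) (m t : R) :
  (forall i, 0 <= w i) -> m <= t ->
  \sum_(i | m < x i) w i <= (\sum_i w i) / 2%:R ->
  \sum_i w i * `|x i - m| <= \sum_i w i * `|x i - t|.
Proof.
move=> w_ge0 le_mt half_above; rewrite -subr_ge0 -sumrB.
have gain i : w i * (t - m) - (if m < x i then w i else 0) * (2%:R * (t - m))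
    <= w i * `|x i - t| - w i * `|x i - m|.
  rewrite -mulrBr; case: ltP => [lt_mx | le_xm].
    have -> : w i * (t - m) - w i * (2%:R * (t - m)) = w i * (m - t) by lra.
    apply: ler_wpM2l => //; rewrite (gtr0_norm (x := x i - m)) ?subr_gt0 //.
    by have := ler_norm (x i - t); have := ler_norm (t - x i); lra.
  rewrite mul0r subr0; apply: ler_wpM2l => //.
  rewrite ler0_norm ?subr_le0 ?(le_trans le_xm) // ler0_norm ?subr_le0 //.
  lra.
apply: le_trans (ler_sum _ (fun i _ => gain i)).
rewrite sumrB -!mulr_suml -big_mkcond /=.
have -> : (\sum_i w i) * (t - m) - (\sum_(i | m < x i) w i) * (2%:R * (t - m))
    = ((\sum_i w i) / 2%:R - \sum_(i | m < x i) w i) * (2%:R * (t - m)).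
  lra.
by rewrite mulr_ge0 ?subr_ge0 // mulr_ge0 ?ler0n // subr_ge0.
Qed.

(** The case of a move to the left reduces to that of a move to the right by
    reflecting the line. *)
Lemma weighted_median_minimizes (R : realFieldType) (p : nat)
    (x w : 'I_p.+1 -> R) (m t : R) :
  weighted_median x w m ->
  \sum_i w i * `|x i - m| <= \sum_i w i * `|x i - t|.
Proof.
case=> w_ge0 _ half_below half_above.
have [le_mt | /ltW le_tm] := leP m t; first exact: weighted_dist_le_right.
have reflect s : \sum_i w i * `|x i - s| = \sum_i w i * `|- x i - - s|.
  by apply: eq_bigr => i _; rewrite -opprD normrN.
rewrite !reflect; apply: weighted_dist_le_right; rewrite ?lerN2 //.
by under eq_bigl do rewrite ltrN2.
Qed.

(** The least point with at most half of the weight strictly above it is a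
    median: the next smaller value, if any, has more than half of the weight
    strictly above it, and this is the weight that is not strictly below the
    chosen point. *)
Lemma weighted_median_exists (R : realFieldType) (p : nat)
    (x w : 'I_p.+1 -> R) :
  (forall i, 0 <= w i) -> exists m, weighted_median x w m.
Proof.
move=> w_ge0; have W_ge0 : 0 <= \sum_i w i by exact: sumr_ge0.
have W2_ge0 : 0 <= (\sum_i w i) / 2%:R by rewrite divr_ge0 ?ler0n.
pose P j := \sum_(i | x j < x i) w i <= (\sum_i w i) / 2%:R.
have [top _ topP] := @Order.TotalTheory.arg_maxP _ R _ ord0 xpredT x isT.
have Ptop : P top.
  by rewrite /P big_pred0 // => i; apply/negbTE; rewrite -leNgt; exact: topP.
have [j Pj jmin] := @Order.TotalTheory.arg_minP _ R _ top P x Ptop.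
exists (x j); split => //.
  by apply/andP; split; [exact: bigmin_le_cond | exact: le_bigmax_cond].
(* [l] indexes the next smaller value. *)
have [i0 lt_i0 | none_below] := pickP (fun i => x i < x j); last first.
  by rewrite big_pred0.
have [l lt_lj lmax] :=
  @Order.TotalTheory.arg_maxP _ R _ i0 (fun i => x i < x j) x lt_i0.
have : ~~ P l by apply: contraL lt_lj => Pl; rewrite -leNgt jmin.
have above_l i : (x l < x i) = ~~ (x i < x j).
  rewrite -leNgt; apply/idP/idP => [lt_li | /(lt_le_trans lt_lj) //].
  by rewrite leNgt; apply: contraL lt_li => /lmax; rewrite -leNgt.
rewrite /P -ltNge (eq_bigl _ _ above_l).
rewrite (bigID (fun i => x i < x j) xpredT w) /=; lra.
Qed.

Section Bound.

Variables (R : realFieldType) (p : nat) (lam : 'I_p.+1 -> R).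
Hypothesis lam_noninc : forall i j : 'I_p.+1, (i <= j)%N -> lam j <= lam i.
Hypothesis lam_pos : 0 < lam ord_max.

Lemma lam_gt0 i : 0 < lam i.
Proof. by apply: lt_le_trans lam_pos _; apply: lam_noninc; exact: leq_ord. Qed.

Lemma CD_ge theta : 0 < theta -> lam ord0 / lam ord_max <= CD lam theta.
Proof.
move=> theta_gt0; rewrite /CD; case: ifP => [le0 | _].
  by rewrite ler_pM2r // invr_gt0.
case: (leP (lam ord_max) theta) => [// | /ltW lt_max].
by rewrite ler_pM2l ?lam_gt0 // lef_pV2 // posrE.
Qed.

Lemma CD_spectrum theta : lam ord_max <= theta <= lam ord0 ->
  CD lam theta = lam ord0 / lam ord_max.
Proof.
case/andP=> le_max le_0; rewrite /CD le_max; case: leP => // ge_0.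
by rewrite (@le_anti _ _ theta (lam ord0)) // le_0.
Qed.

Lemma weighted_median_spectrum w m : weighted_median lam w m ->
  lam ord_max <= m <= lam ord0.
Proof.
case=> _ /andP[ge_min le_max] _ _; apply/andP; split.
  apply: le_trans ge_min; apply/bigmin_geP; split=> [|i _];
    exact/lam_noninc/leq_ord.
by apply: le_trans le_max _; apply/bigmax_leP; split=> // i _; exact: lam_noninc.
Qed.

Lemma sum_relative_dist theta :
  \sum_i `|1 - theta / lam i| = \sum_i 1 / lam i * `|lam i - theta|.
Proof.
apply: eq_bigr => i _; have lam_i := lam_gt0 i.
rewrite -[1 / _]gtr0_norm ?divr_gt0 // -normrM mulrBr mul1r mulVf ?gt_eqF //.
by rewrite [theta / _]mulrC.
Qed.

End Bound.

Theorem corollary3p5 (R : realFieldType) (u : R) (n p : nat)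
    (lam : 'I_p.+1 -> R)
    (hu : 0 < u) (hkn : (p.+1 <= n)%N) (hnu : n%:R * u < 1)
    (hlam_noninc : forall i j : 'I_p.+1, (i <= j)%N -> lam j <= lam i)
    (hlam_pos : 0 < lam ord_max) :
  (exists m : R, weighted_median lam (fun i => 1 / lam i) m) /\
  (forall m : R, weighted_median lam (fun i => 1 / lam i) m ->
     minimizer_on_pos (fwd_bound u n lam) m).
Proof.
have lam_gt0 := @lam_gt0 R p lam hlam_noninc hlam_pos.
split=> [|m med_m].
  by apply: weighted_median_exists => i; rewrite divr_ge0 // ltW.
have m_in := weighted_median_spectrum _ _ _ hlam_noninc _ _ med_m.
split=> [|theta theta_gt0]; first by case/andP: m_in => /(lt_le_trans hlam_pos).
have gamma_ge0 : 0 <= gamma u n.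
  by rewrite divr_ge0 ?subr_ge0 ?mulr_ge0 ?ler0n ?(ltW hu) ?(ltW hnu).
rewrite /fwd_bound CD_spectrum //; apply: ler_pM.
- by rewrite divr_ge0 // ltW.
- by apply: addr_ge0; apply: mulr_ge0 => //; [exact: ltW | exact: sumr_ge0].
- exact: CD_ge.
by rewrite lerD2l ler_wpM2l // !sum_relative_dist // weighted_median_minimizes.
Qed.
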